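(* Let $n\geq 3$, let $\mathcal{D}_n$ be the dihedral group of order $2n$, and let $\mathbb{F}$ be an arbitrary field. Then the length $l(\mathbb{F}\mathcal{D}_n)$ of the group algebra $\mathbb{F}\mathcal{D}_n$ satisfies: if $n$ is odd, then $l(\mathbb{F}\mathcal{D}_n)=n$; if $n$ is even, then $l(\mathbb{F}\mathcal{D}_n)\in\{n,n+1\}$.
   Context: Let $\mathcal{A}$ be an associative finite-dimensional algebra with identity $1_{\mathcal{A}}$ over a field $\mathbb{F}$. For a finite subset $\mathcal{S}\subset\mathcal{A}$ and $i\ge 0$, $\mathcal{L}_i(\mathcal{S})$ denotes the $\mathbb{F}$-linear span of all products of at most $i$ elements of $\mathcal{S}$ (repetitions allowed), where the empty product is $1_{\mathcal{A}}$. Put $\mathcal{L}(\mathcal{S})=\bigcup_{i\ge 0}\mathcal{L}_i(\mathcal{S})$. The set $\mathcal{S}$ is a generating set of $\mathcal{A}$ if $\mathcal{L}(\mathcal{S})=\mathcal{A}$. The length of a generating set $\mathcal{S}$ is $l(\mathcal{S})=\min\{k\in\mathbb{Z}_{\ge 0}:\mathcal{L}_k(\mathcal{S})=\mathcal{A}\}$, and the length of the algebra is $l(\mathcal{A})=\max\{l(\mathcal{S}):\mathcal{L}(\mathcal{S})=\mathcal{A}\}$. *)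

(* Defs.v *)
From HB Require Import structures.
From mathcomp Require Import all_boot all_order all_algebra all_fingroup.
From mathcomp Require Import all_solvable all_field.
From mathcomp Require Import finmap.

Set Implicit Arguments.
Unset Strict Implicit.
Unset Printing Implicit Defensive.

Import GRing.Theory.
Local Open Scope ring_scope.

Section GroupAlgebra.

Variables (F : fieldType) (gT : finGroupType).

(* An alias of the coordinate functions, with its own ring structure: the ring *)
(* structure the library puts on {ffun gT -> F} is the pointwise product.      *)
(* F^o rather than F, so that the space of functions is a vector space over F. *)
Definition group_algebra : Type := {ffun gT -> F^o}.

HB.instance Definition _ := Vector.on group_algebra.

Implicit Types x y z : group_algebra.

Definition ga_elt (g : gT) : group_algebra := [ffun h => (h == g)%:R].

Definition ga_mul x y : group_algebra :=
  [ffun g => \sum_h x h * y (h^-1 * g)%g].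

Fact ga_mulA : associative ga_mul.
Proof.
move=> x y z; apply/ffunP=> g; rewrite !ffunE.
under eq_bigr => h _ do rewrite ffunE mulr_sumr.
under [RHS]eq_bigr => h _ do rewrite ffunE mulr_suml.
rewrite [RHS]exchange_big /=; apply: eq_bigr => h _.
rewrite [RHS](reindex_inj (mulgI h)) /=; apply: eq_bigr => k _.
by rewrite mulKg invMg !mulgA mulrA.
Qed.

Fact ga_mul1x : left_id (ga_elt 1%g) ga_mul.
Proof.
move=> x; apply/ffunP=> g; rewrite ffunE (bigD1 1%g) //= big1 => [|h /negPf h1].
  by rewrite ffunE eqxx mul1r invg1 mul1g addr0.
by rewrite ffunE h1 mul0r.
Qed.

Fact ga_mulx1 : right_id (ga_elt 1%g) ga_mul.
Proof.
move=> x; apply/ffunP=> g; rewrite ffunE (bigD1 g) //= big1 => [|h h1].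
  by rewrite ffunE mulVg eqxx mulr1 addr0.
by rewrite ffunE -eq_mulVg1 (negPf h1) mulr0.
Qed.

Fact ga_mulDl : left_distributive ga_mul +%R.
Proof.
move=> x y z; apply/ffunP=> g; rewrite !ffunE -big_split /=.
by apply: eq_bigr => h _; rewrite ffunE mulrDl.
Qed.

Fact ga_mulDr : right_distributive ga_mul +%R.
Proof.
move=> x y z; apply/ffunP=> g; rewrite !ffunE -big_split /=.
by apply: eq_bigr => h _; rewrite ffunE mulrDr.
Qed.

Fact ga_one_neq0 : ga_elt 1%g != 0.
Proof.
apply/eqP=> /ffunP/(_ 1%g); rewrite !ffunE eqxx.
by apply/eqP; rewrite oner_eq0.
Qed.

HB.instance Definition _ := GRing.Zmodule_isNzRing.Build group_algebra
  ga_mulA ga_mul1x ga_mulx1 ga_mulDl ga_mulDr ga_one_neq0.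

Fact ga_scaleAl (a : F) x y : a *: (x * y) = (a *: x) * y.
Proof.
apply/ffunP=> g; rewrite !ffunE scaler_sumr.
by apply: eq_bigr => h _; rewrite ffunE -scalerAl.
Qed.

HB.instance Definition _ :=
  GRing.Lmodule_isLalgebra.Build F group_algebra ga_scaleAl.

Fact ga_scaleAr (a : F) x y : a *: (x * y) = x * (a *: y).
Proof.
apply/ffunP=> g; rewrite !ffunE scaler_sumr.
by apply: eq_bigr => h _; rewrite ffunE scalerAr.
Qed.

HB.instance Definition _ :=
  GRing.Lalgebra_isAlgebra.Build F group_algebra ga_scaleAr.

HB.instance Definition _ := Algebra_isFalgebra.Build F group_algebra.

Lemma ga_eltM (g h : gT) : ga_elt (g * h)%g = ga_elt g * ga_elt h.
Proof.
apply/ffunP=> k; rewrite !ffunE (bigD1 g) //= big1 => [|l lg].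
  by rewrite !ffunE eqxx mul1r addr0; rewrite -(inj_eq (mulgI g) _ h) mulKVg.
by rewrite ffunE (negPf lg) mul0r.
Qed.

Lemma ga_elt1 : ga_elt 1%g = 1.
Proof. by []. Qed.

Lemma ga_sum_elt x : x = \sum_g x g *: ga_elt g.
Proof.
apply/ffunP=> h; rewrite sum_ffunE (bigD1 h) //= big1 => [|g gh].
  by rewrite !ffunE eqxx addr0 /GRing.scale /= mulr1.
by rewrite !ffunE eq_sym (negPf gh) scaler0.
Qed.

End GroupAlgebra.

Section Length.

Variables (F : fieldType) (A : falgType F).
Implicit Types (S : {fset A}) (i j k l : nat).

(* A product of j elements of S is given by a word of length j in S; the       *)
(* product over the empty word is 1.                                           *)
Definition words_span i S : {vspace A} :=
  (\sum_(j < i.+1) \sum_(w : j.-tuple S) <[\prod_(a <- w) val a]>)%VS.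

Definition generating S : Prop := forall a : A, exists i, a \in words_span i S.

Definition is_set_length S k : Prop :=
  words_span k S = fullv /\ (forall j, words_span j S = fullv -> (k <= j)%N).

Definition is_algebra_length l : Prop :=
  (exists S, generating S /\ is_set_length S l) /\
  (forall S k, generating S -> is_set_length S k -> (k <= l)%N).

Lemma words_spanS S i j : (i <= j)%N -> (words_span i S <= words_span j S)%VS.
Proof.
move=> le_ij; apply/subv_sumP=> k _; have ltkj : (k < j.+1)%N.
  exact: leq_trans (ltn_ord k) _.
exact: (sumv_sup (Ordinal ltkj)).
Qed.

Lemma generating_length S : generating S -> exists k, is_set_length S k.
Proof.
move=> genS; have [K SK] : exists K, words_span K S == fullv.
  have bound (s : seq A) : exists K, {subset s <= words_span K S}.
    elim: s => [|a s [K sK]]; first by exists 0.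
    have [i ai] := genS a; exists (maxn i K) => b /predU1P[->|/sK bK].
      exact: subvP (words_spanS S (leq_maxl i K)) _ ai.
    exact: subvP (words_spanS S (leq_maxr i K)) _ bK.
  have [K sK] := bound (vbasis {:A}); exists K; rewrite eqEsubv subvf /=.
  by rewrite -(span_basis (vbasisP {:A})); apply/span_subvP.
have exk : exists k, words_span k S == fullv by exists K.
exists (ex_minn exk); case: ex_minnP => k /eqP Sk min_k.
by split=> // j /eqP/min_k.
Qed.

Lemma algebra_length_uniq k l :
  is_algebra_length k -> is_algebra_length l -> k = l.
Proof.
move=> [[S [gS lS]] maxk] [[T [gT lT]] maxl].
by apply/eqP; rewrite eqn_leq (maxl S k) // (maxk T l).
Qed.

End Length.

(* Main.v *)
Require Import Defs.
From HB Require Import structures.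
From mathcomp Require Import all_boot all_order all_algebra all_fingroup.
From mathcomp Require Import all_solvable all_field.
From mathcomp Require Import finmap.
From Stdlib Require Import Classical_Prop.

Set Implicit Arguments.
Unset Strict Implicit.
Unset Printing Implicit Defensive.

Import GRing.Theory.
Local Open Scope ring_scope.

(* Write L_k for words_span k S.  If dim L_k grows by at least 2 at each step  *)
(* before the last one, then 2 l(S) <= dim A = 2n.  Otherwise some step grows  *)
(* by exactly 1, and then L_k, L_(k+1), ... are obtained by adding powers of a *)
(* single x in S, so that l(S) is less than the degree of x over F.  Every x   *)
(* is quadratic over the central subring R of the inversion-invariant elements *)
(* supported on the rotations, and dim R = n/2 + 1 (rounded down), whence      *)
(* l(S) <= 2 (n/2) + 1.  Conversely, for S made of two adjacent reflections,   *)
(* L_k is spanned by the 2k + 1 alternating words of length at most k, hence   *)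
(* l(S) >= n.                                                                  *)

(** The upper bound is the dichotomy [set_length_bound], applied with the [x]-stable spaces R + R x
    of [stable_sym_space]: each [x] satisfies x^2 = t x - m with t, m in the central subring R, so
    its powers span at most 2 dim R <= 2 (n/2 + 1) dimensions ([dim_sym_space_cycle]). The resulting
    bound 2 (n/2) + 1 equals [n] for odd [n] and [n + 1] for even [n]; this is where parity enters.
    Against it, [long_generating_set] needs only the count 2n <= 2k + 1. *)

Section FiltrationLength.

Variables (F : fieldType) (A : falgType F).
Implicit Types (S : {fset A}) (U V : {vspace A}) (x v : A) (i j k l d : nat).

Lemma memv_preim_amull U x v : (v \in amull x @^-1: U)%VS = (x * v \in U).
Proof. by rewrite -memv_preim lfunE. Qed.

Lemma mem_words_span S i (w : seq S) :
  (size w <= i)%N -> \prod_(a <- w) val a \in words_span i S.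
Proof.
move=> wi; have wi1 : (size w < i.+1)%N by [].
apply: (subvP (sumv_sup (Ordinal wi1) isT (subvv _))).
by apply: (subvP (sumv_sup (in_tuple w) isT (subvv _))); apply: memv_line.
Qed.

Lemma words_span_sub S i U :
    (forall w : seq S, (size w <= i)%N -> \prod_(a <- w) val a \in U) ->
  (words_span i S <= U)%VS.
Proof.
move=> wU; apply/subv_sumP=> j _; apply/subv_sumP=> w _; rewrite -memvE.
by apply: wU; rewrite size_tuple -ltnS.
Qed.

Lemma words_span_one S i : 1 \in words_span i S.
Proof. by have:= @mem_words_span S i [::] isT; rewrite big_nil. Qed.

Lemma words_spanMl S i (a : S) v :
  v \in words_span i S -> val a * v \in words_span i.+1 S.
Proof.
rewrite -memv_preim_amull; apply/subvP/words_span_sub => w wi.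
by rewrite memv_preim_amull -(big_cons _ _ a w xpredT) mem_words_span.
Qed.

Lemma words_spanMr S i (a : S) v :
  v \in words_span i S -> v * val a \in words_span i.+1 S.
Proof.
have -> : v * val a = amulr (val a) v by rewrite lfunE.
rewrite memv_preim; apply/subvP/words_span_sub => w wi.
by rewrite -memv_preim lfunE /= -big_rcons /= mem_words_span ?size_rcons.
Qed.

Lemma words_span_closed S i U :
    1 \in U -> (forall (a : S) v, v \in U -> val a * v \in U) ->
  (words_span i S <= U)%VS.
Proof.
move=> U1 UM; apply: words_span_sub => w _.
by elim: w => [|a w IHw]; rewrite ?big_nil // big_cons UM.
Qed.

(** If L_(k+1) = L_k, then L_k contains 1 and is stable under left multiplication by S, so it
    contains every L_i. *)
Lemma generating_stable S k :
  generating S -> (words_span k.+1 S <= words_span k S)%VS ->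
  words_span k S = fullv.
Proof.
move=> genS sLk; apply/eqP; rewrite eqEsubv subvf; apply/subvP=> a _.
have [i] := genS a; apply/subvP; apply: words_span_closed.
  exact: words_span_one.
by move=> b v vL; apply: (subvP sLk); apply: words_spanMl.
Qed.

Lemma words_span_subPn S i U :
    ~~ (words_span i S <= U)%VS ->
  exists2 w : seq S, (size w <= i)%N & \prod_(a <- w) val a \notin U.
Proof.
move=> nsLU; have [/forallP allU | ] := boolP [forall j : 'I_i.+1,
    forall w : j.-tuple S, \prod_(a <- w) val a \in U].
  case/negP: nsLU; apply/subv_sumP=> j _; apply/subv_sumP=> w _.
  by rewrite -memvE; apply: (forallP (allU j)).
case/forallPn=> j /forallPn[w wU]; exists w => //.
by rewrite size_tuple -ltnS.
Qed.

Lemma subv_add_line U V v :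
    (U <= V)%VS -> (\dim V <= (\dim U).+1)%N -> v \in V -> v \notin U ->
  (V <= U + <[v]>)%VS.
Proof.
move=> sUV dVU Vv nUv; have sUvV : (U + <[v]> <= V)%VS.
  by rewrite subv_add sUV -memvE.
rewrite -(geq_leqif (dimv_leqif_sup sUvV)) (leq_trans dVU) //.
rewrite ltn_neqAle (dimv_leqif_sup (addvSl U _)).1 andbT.
rewrite (dimv_leqif_sup (addvSl U _)).2.
by rewrite subv_add subvv -memvE.
Qed.

(* If L_(k+1) / L_k is a line and L_(k+1) != L_(k+2), left multiplication by   *)
(* the first letter a of a word outside L_(k+1) maps L_(k+1) \ L_k outside     *)
(* L_(k+1); so the letters of a word outside L_k can be traded for a's, each   *)
(* time dropping the last letter and adding an a in front.                     *)
Lemma line_step_power S k :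
    (\dim (words_span k.+1 S) <= (\dim (words_span k S)).+1)%N ->
    ~~ (words_span k.+2 S <= words_span k.+1 S)%VS ->
  exists a : S, val a ^+ k.+1 \notin words_span k S.
Proof.
move=> dL /words_span_subPn[[|a w] /=]; first by rewrite big_nil words_span_one.
rewrite big_cons ltnS => wk nLaw; exists a.
have nLM v : v \in words_span k.+1 S -> v \notin words_span k S ->
    val a * v \notin words_span k.+1 S.
  move=> Lv nLv; apply: contra nLaw => Lav.
  have /subvP/(_ _ (mem_words_span wk)) :=
    subv_add_line (words_spanS S (leqnSn k)) dL Lv nLv.
  case/memv_addP=> u Lu [_ /vlineP[c ->] ->].
  by rewrite mulrDr -scalerAr memvD ?memvZ // words_spanMl.
have nLw : \prod_(b <- w) val b \notin words_span k S.
  by apply: contra nLaw; apply: words_spanMl.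
suff /(_ k.+1 0%N): forall j m, (j + m)%N = k.+1 ->
    \prod_(b <- nseq j a ++ take m w) val b \notin words_span k S.
  rewrite addn0 take0 cats0 big_nseq iter_mulr_1; exact.
elim=> [|j IHj] m; first by rewrite add0n => ->; rewrite take_oversize.
rewrite addSnnS => jm; have sz : (size (nseq j a ++ take m.+1 w) <= k.+1)%N.
  by rewrite size_cat size_nseq -jm leq_add2l size_take_min geq_minl.
apply: contra (nLM _ (mem_words_span sz) (IHj _ jm)); rewrite /= big_cons.
have [mw | wm] := ltnP m (size w); last first.
  rewrite !take_oversize ?(leq_trans wm) //.
  exact: (subvP (words_spanS S (leqnSn k))).
rewrite (take_nth a) // -rcons_cat big_rcons /= mulrA.
exact: words_spanMr.
Qed.

Lemma mem_words_span_exp S i (a : S) : val a ^+ i \in words_span i S.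
Proof.
have := @mem_words_span S i (nseq i a).
by rewrite size_nseq big_nseq iter_mulr_1; apply.
Qed.

(** By induction: modulo L_j a word of length j + 1 is a multiple of a^(j+1), and appending a letter
    b gives a^(j+1) b = a (a^j b), where a^j b is again a multiple of a^(j+1) modulo L_j. *)
Lemma power_step S k (a : S) j :
    (words_span k.+1 S <= words_span k S + <[val a ^+ k.+1]>)%VS ->
    (k <= j)%N ->
  (words_span j.+1 S <= words_span j S + <[val a ^+ j.+1]>)%VS.
Proof.
move=> Lk; elim: j => [|j IHj]; first by rewrite leqn0 => /eqP <-.
rewrite leq_eqVlt => /predU1P[<- //| /IHj/subvP Lj].
apply: words_span_sub => w; case/lastP: w => [_|w b].
  by rewrite big_nil (subvP (addvSl _ _)) // words_span_one.
rewrite size_rcons ltnS big_rcons /= => wj.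
have /Lj/memv_addP[u Lu [_ /vlineP[c ->] ->]] := mem_words_span wj.
have /Lj/memv_addP[v Lv [_ /vlineP[e ->] vE]] :=
  words_spanMr b (mem_words_span_exp j a).
rewrite mulrDl -scalerAl {1}exprS -mulrA vE mulrDr scalerDr addrA -scalerAr -exprS.
rewrite memv_add ?memvZ ?memv_line //.
by rewrite memvD ?memvZ ?words_spanMr ?words_spanMl.
Qed.

(* Either dim L_k grows by at least 2 at each step before the last one, or     *)
(* from some step on the powers of a single x span L_(k+1) modulo L_k; in the  *)
(* latter case 1, x, ..., x^l are linearly independent.                        *)
Lemma set_length_bound d S l :
    (forall x, exists2 U, (\dim U <= d)%N &
       1 \in U /\ forall v, v \in U -> x * v \in U) ->
    generating S -> is_set_length S l ->
  (l.*2 <= \dim {:A})%N || (l < d)%N.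
Proof.
move=> degU genS [Ll minl]; case: l => // l in Ll minl *.
have ltL k : (k < l.+1)%N -> ~~ (words_span k.+1 S <= words_span k S)%VS.
  by move=> kl; apply/negP=> /(generating_stable genS)/minl; rewrite leqNgt kl.
have [/forallP step2 | ] := boolP [forall k : 'I_l,
    (\dim (words_span k S)).+2 <= \dim (words_span k.+1 S)]%N.
  have dimL k : (k <= l)%N -> (k.*2 < \dim (words_span k S))%N.
    elim: k => [_|k IHk kl].
      rewrite lt0n dimv_eq0; apply/eqP=> L0; have := words_span_one S 0.
      by rewrite L0 memv0 oner_eq0.
    rewrite doubleS; apply: leq_trans (step2 (Ordinal kl)).
    by rewrite ltnS ltnS (IHk (ltnW kl)).
  (* The length is now [l.+1]: dim L_l > 2l and the last step is still strict, so dim A >= 2l +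
     2. *)
  apply/orP; left; rewrite -Ll doubleS.
  apply: leq_ltn_trans (dimL l (leqnn l)) _.
  have sLl := words_spanS S (leqnSn l).
  rewrite ltn_neqAle (dimv_leqif_sup sLl).1 andbT.
  by rewrite (dimv_leqif_sup sLl).2 ltL.
case/forallPn=> k; rewrite -ltnNge ltnS => dLk; apply/orP; right.
have kl := ltn_ord k; have [||a na] := @line_step_power S k; rewrite ?ltL //.
have Lk := subv_add_line (words_spanS S (leqnSn k)) dLk
  (mem_words_span_exp _ a) na.
have nal : val a ^+ l.+1 \notin words_span l S.
  have := power_step Lk (ltnW kl); apply: contraL => al.
  apply: contra (ltL l (leqnn _)) => /subv_trans; apply.
  by rewrite subv_add subvv -memvE.
(* Descent from [l]: if a^(j+1) were in L_j, then a^(j+2) would be in L_(j+1). *)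
have naj j : (j <= l)%N -> val a ^+ j.+1 \notin words_span j S.
  move/subnK; move: (l - j)%N => i; elim: i j => [|i IHi] j.
    by rewrite add0n => ->.
  rewrite addSnnS => /IHi; apply: contra => aj.
  by rewrite exprS words_spanMl.
have [U dU [U1 UM]] := degU (val a); apply: leq_trans dU.
have Ua j : val a ^+ j \in U by elim: j => // j IHj; rewrite exprS UM.
(* [U] contains F[a], so a^(j+1) makes U :&: L_j grow strictly at each step. *)
suff dUL j : (j <= l.+1)%N -> (j < \dim (U :&: words_span j S))%N.
  by apply: leq_trans (dUL _ (leqnn _)) _; rewrite dimvS ?capvSl.
elim: j => [_|j IHj jl].
  rewrite lt0n dimv_eq0; apply/eqP=> UL0.
  have : 1 \in (U :&: words_span 0 S)%VS by rewrite memv_cap U1 words_span_one.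
  by rewrite UL0 memv0 oner_eq0.
apply: leq_ltn_trans (IHj (ltnW jl)) _.
have sUL : (U :&: words_span j S <= U :&: words_span j.+1 S)%VS.
  by rewrite capvS ?words_spanS.
rewrite ltn_neqAle (dimv_leqif_sup sUL).1 andbT (dimv_leqif_sup sUL).2.
apply: contra (naj j jl) => /subvP/(_ (val a ^+ j.+1)).
by rewrite !memv_cap Ua mem_words_span_exp => /(_ isT)/andP[].
Qed.

End FiltrationLength.

(** * Words in two involutions *)

Section AlternatingProducts.

Variables (F : fieldType) (A : falgType F).
Implicit Types (x y v : A) (S : {fset A}) (j : nat).

Fixpoint alt_prod x y j : A := if j is i.+1 then x * alt_prod y x i else 1.

Fixpoint alt_span x y j : {vspace A} :=
  if j is i.+1 then
    (alt_span x y i + (<[alt_prod x y j]> + <[alt_prod y x j]>))%VS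
  else <[1]>%VS.

Lemma alt_spanC x y j : alt_span x y j = alt_span y x j.
Proof. by elim: j => //= j ->; congr (_ + _)%VS; rewrite addvC. Qed.

Lemma dim_alt_span x y j : (\dim (alt_span x y j) <= j.*2.+1)%N.
Proof.
elim: j => [|j IHj] /=; first by rewrite dim_vline leq_b1.
apply: leq_trans (dimv_add_leqif _ _) _; rewrite doubleS.
rewrite -[X in (_ <= X)%N]addn2 leq_add //.
apply: leq_trans (dimv_add_leqif _ _) _.
by rewrite !dim_vline; apply: (leq_add (leq_b1 _) (leq_b1 _)).
Qed.

Lemma alt_prod_in_span x y j :
  alt_prod x y j \in alt_span x y j /\ alt_prod y x j \in alt_span x y j.
Proof.
case: j => [|j] /=; first by rewrite memv_line.
have s : (<[x * alt_prod y x j]> + <[y * alt_prod x y j]> <= alt_span x y j.+1)%VS.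
  exact: addvSr.
by split; apply: (subvP s); [rewrite (subvP (addvSl _ _))|
  rewrite (subvP (addvSr _ _))]; rewrite ?memv_line.
Qed.

Lemma alt_spanS x y i j : (i <= j)%N -> (alt_span x y i <= alt_span x y j)%VS.
Proof.
elim: j => [|j IHj]; first by rewrite leqn0 => /eqP->.
rewrite leq_eqVlt => /predU1P[->//|/IHj/subv_trans]; apply.
exact: addvSl.
Qed.

(** Multiplying an alternating word by [x] lengthens it if it starts with [y], and cancels its first
    letter if it starts with [x]. *)
Lemma alt_spanM x y v j :
  x * x = 1 -> v \in alt_span x y j -> x * v \in alt_span x y j.+1.
Proof.
move=> xx; rewrite -memv_preim_amull; apply/subvP.
elim: j => [|j IHj].
  by rewrite -memvE memv_preim_amull; have [] := alt_prod_in_span x y 1.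
rewrite [alt_span x y j.+1 in X in (X <= _)%VS]/= !subv_add -!memvE.
rewrite !memv_preim_amull; apply/and3P; split.
- by apply: subv_trans IHj _; apply: lpreimS; apply: alt_spanS.
- rewrite mulrA xx mul1r.
  apply: (subvP (alt_spanS x y (leqW (leqnSn j)))).
  by have [] := alt_prod_in_span x y j.
by have [] := alt_prod_in_span x y j.+2.
Qed.

Lemma words_span_involutions x y S j :
    {subset S <= [:: x; y]} -> x * x = 1 -> y * y = 1 ->
  (words_span j S <= alt_span x y j)%VS.
Proof.
move=> sS xx yy; apply: words_span_sub => w.
elim: w j => [|a w IHw] j; rewrite ?big_nil ?big_cons.
  by move=> _; apply: (subvP (@alt_spanS x y 0 j isT)); apply: memv_line.
case: j => // j /IHw wj; have := sS _ (valP a); rewrite !inE.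
case/orP=> /eqP->; first exact: alt_spanM.
by rewrite alt_spanC; apply: alt_spanM; rewrite // alt_spanC.
Qed.

End AlternatingProducts.

(** * Dimension and generators of a group algebra *)

Lemma dim_group_algebra (F : fieldType) (gT : finGroupType) :
  \dim {:group_algebra F gT} = #|gT|.
Proof. by rewrite dimvf /dim /= muln1. Qed.

(** In a finite group every element is a product of generators without inverses, so each basis
    element [ga_elt F g] lies in some L_i. *)
Lemma generating_group_elements (F : fieldType) (gT : finGroupType) (B : {set gT})
    (S : {fset group_algebra F gT}) :
    <<B>>%g = [set: gT] -> (forall g, g \in B -> ga_elt F g \in S) ->
  generating S.
Proof.
move=> genB BS; have eltL (g : gT) : exists i, ga_elt F g \in words_span i S.
  have : g \in <<B>>%g by rewrite genB inE.
  case/gen_prodgP=> m [c Bc ->]; exists m.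
  elim: m c Bc => [|m IHm] c Bc; first by rewrite big_ord0 ga_elt1 words_span_one.
  rewrite big_ord_recl ga_eltM.
  exact: (words_spanMl (FSetSub (BS _ (Bc ord0))) (IHm _ (fun i => Bc _))).
move=> a; rewrite [a]ga_sum_elt.
elim/big_ind: _ => [|x y [i xi] [j yj] | g _]; first by exists 0; rewrite mem0v.
  exists (maxn i j); rewrite memvD //.
    exact: subvP (words_spanS S (leq_maxl i j)) _ xi.
  exact: subvP (words_spanS S (leq_maxr i j)) _ yj.
by have [i gi] := eltL g; exists i; rewrite memvZ.
Qed.

(** * The central subring R and quadratic equations over it *)

Section GeneralizedDihedral.

Variables (F : fieldType) (gT : finGroupType) (H : {group gT}).
Hypothesis notHM : forall g h : gT, g \notin H -> h \notin H -> (g * h)%g \in H.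
Hypothesis notH_inv : forall g : gT, g \notin H -> (g * g)%g = 1%g.
Hypothesis properH : exists b : gT, b \notin H.

Local Notation A := (group_algebra F gT).
Implicit Types (g h k : gT) (x z r : A).

Lemma ga_mulE x z g : (x * z) g = \sum_h x h * z (h^-1 * g)%g.
Proof. by rewrite [x * z]/(ga_mul x z) ffunE. Qed.

Lemma notH_invE g : g \notin H -> (g^-1)%g = g.
Proof. by move/notH_inv/eqP; rewrite -eq_invg_mul => /eqP. Qed.

Lemma notH_mulH g h : g \notin H -> (g * h \in H)%g = (h \notin H).
Proof.
move=> ng; have [Hh|/(notHM ng) //] := boolP (h \in H).
by rewrite groupMr // (negPf ng).
Qed.

Lemma notH_swap g h : g \notin H -> h \in H -> (g * h)%g = (h^-1 * g)%g.
Proof.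
move=> ng Hh; have ngh : (g * h)%g \notin H by rewrite notH_mulH ?Hh.
by rewrite -(notH_invE ngh) invMg (notH_invE ng).
Qed.

(** Conjugation by an element outside [H] inverts [H]; inversion is a homomorphism only on an
    abelian group. *)
Lemma H_comm g h : g \in H -> h \in H -> (g * h = h * g)%g.
Proof.
move=> Hg Hh; have [b nb] := properH.
apply: (mulgI b); rewrite (notH_swap nb (groupM Hg Hh)) invMg.
by rewrite mulgA (notH_swap nb Hh) -!mulgA (notH_swap nb Hg).
Qed.

(** The two conditions defining R, support in [H] and invariance under inversion, packed in one
    linear map so that R is its kernel. *)
Definition sym_defect z : A :=
  [ffun g => if g \in H then z g - z (g^-1)%g else z g].

Fact sym_defect_is_linear : linear sym_defect.
Proof.
move=> a x z; apply/ffunP=> g; rewrite !ffunE; case: ifP => // _.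
by rewrite scalerBr opprD addrACA.
Qed.

HB.instance Definition _ :=
  GRing.isLinear.Build F A A *:%R sym_defect sym_defect_is_linear.

Definition sym_space : {vspace A} := lker (linfun sym_defect).

Lemma sym_spaceP r :
  reflect ((forall g, g \notin H -> r g = 0) /\ (forall g, r (g^-1)%g = r g))
          (r \in sym_space).
Proof.
rewrite memv_ker lfunE; apply: (iffP eqP) => [r0 | [r0 rV]].
  have rE g : (if g \in H then r g - r (g^-1)%g else r g) = 0.
    by move/ffunP/(_ g): r0; rewrite !ffunE.
  split=> g; first by move/negPf=> ng; have := rE g; rewrite ng.
  have := rE g; case: ifPn => [_ /eqP | ng _]; last by rewrite notH_invE.
  by rewrite subr_eq0 => /eqP.
by apply/ffunP=> g; rewrite !ffunE rV subrr; case: ifPn => // /r0.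
Qed.

(** Elements of R are class functions, hence central. For [g], [h] both outside [H], [h * g] is the
    inverse of [g * h]. *)
Lemma sym_class r g h : r \in sym_space -> r (g * h)%g = r (h * g)%g.
Proof.
case/sym_spaceP=> r0 rV.
have [Hg | ng] := boolP (g \in H); have [Hh | nh] := boolP (h \in H).
- by rewrite H_comm.
- by rewrite !r0 // ?(groupMl _ Hg) ?(groupMr _ Hg).
- by rewrite !r0 // ?(groupMl _ Hh) ?(groupMr _ Hh).
by rewrite -rV invMg !notH_invE.
Qed.

Lemma sym_central r x : r \in sym_space -> r * x = x * r.
Proof.
move=> Rr; apply/ffunP=> g; rewrite !ga_mulE.
rewrite (reindex_inj (inj_comp (mulgI g) invg_inj)) /=.
by apply: eq_bigr => h _; rewrite invMg invgK mulgKV mulrC (sym_class _ _ Rr).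
Qed.

Lemma sym_space1 : 1 \in sym_space.
Proof.
apply/sym_spaceP; split=> g; rewrite -ga_elt1 !ffunE ?invg_eq1 //.
by case: eqVneq => // ->; rewrite group1.
Qed.

Lemma sym_spaceM r x : r \in sym_space -> x \in sym_space -> r * x \in sym_space.
Proof.
move=> Rr Rx; case/sym_spaceP: (Rr) => r0 rV; case/sym_spaceP: (Rx) => x0 xV.
apply/sym_spaceP; split=> g => [ng|]; rewrite !ga_mulE.
  apply: big1 => h _; have [Hh | /r0->] := boolP (h \in H); last exact: mul0r.
  by rewrite x0 ?mulr0 // groupMl ?groupV.
rewrite (reindex_inj invg_inj) /=; apply: eq_bigr => h _.
by rewrite rV -[in LHS]xV invMg !invgK (sym_class _ _ Rx).
Qed.

(* The reduced trace x + ga_conj x and norm x * ga_conj x are central and lie  *)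
(* in sym_space, so that x is quadratic over sym_space.                        *)
Definition ga_conj x : A := [ffun g => if g \in H then x (g^-1)%g else - x g].

Lemma sym_trace x : x + ga_conj x \in sym_space.
Proof.
apply/sym_spaceP; split=> g => [/negPf ng|]; rewrite !ffunE ?groupV.
  by rewrite ng subrr.
case: ifPn => [_ | ng]; first by rewrite invgK addrC.
by rewrite notH_invE.
Qed.

Lemma sym_norm x : x * ga_conj x \in sym_space.
Proof.
apply/sym_spaceP; split=> g => [ng|]; rewrite !ga_mulE.
  (* Outside [H] the term of h in H cancels that of g h, thanks to the sign in [ga_conj]. *)
  rewrite (bigID [pred h | h \in H]) /= [X in _ + X](reindex_inj (mulgI g)) /=.
  under [X in _ + X]eq_bigl => h do rewrite notH_mulH // negbK.
  rewrite -big_split big1 //= => h Hh.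
  have -> : ((g * h)^-1 * g = h^-1)%g by rewrite invMg mulgKV.
  rewrite !ffunE groupMl !groupV // (negPf ng) Hh invgK (notH_swap ng Hh).
  by rewrite mulrN mulrC addNr.
rewrite [LHS](bigID [pred h | h \in H]) [RHS](bigID [pred h | h \in H]) /=.
have [Hg | ng] := boolP (g \in H); last by rewrite notH_invE.
congr (_ + _).
  rewrite (reindex_inj (mulgI g^-1)%g) /=.
  under eq_bigl => h do rewrite groupMl ?groupV //.
  apply: eq_bigr => h Hh.
  have -> : ((g^-1 * h)^-1 * g^-1 = h^-1)%g by rewrite invMg invgK mulgK.
  by rewrite !ffunE groupMl !groupV // Hg Hh invgK invMg invgK mulrC.
rewrite (reindex_inj (mulIg g)) /=.
under eq_bigl => h do rewrite groupMr //.
apply: eq_bigr => h nh; have nhg : (h * g)%g \notin H by rewrite groupMr.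
rewrite !ffunE (notH_invE nhg) (notH_invE nh) mulgK.
by rewrite (negPf nh) (negPf nhg) !mulrN mulrC.
Qed.

Lemma stable_sym_space x :
  exists2 U : {vspace A}, (\dim U <= (\dim sym_space).*2)%N &
    1 \in U /\ forall v, v \in U -> x * v \in U.
Proof.
exists (sym_space + sym_space * <[x]>)%VS.
  apply: leq_trans (dimv_add_leqif _ _) _; rewrite -addnn leq_add2l.
  by apply: leq_trans (dim_prodv _ _) _; rewrite dim_vline; case: (_ != 0);
    rewrite ?muln1 ?muln0.
split=> [|v]; first by rewrite (subvP (addvSl _ _)) ?sym_space1.
rewrite -limg_amulr.
case/memv_addP=> r Rr [_ /memv_imgP[s Rs ->] ->]; rewrite lfunE /= mulrDr.
have xxE : x * x = (x + ga_conj x) * x - x * ga_conj x.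
  by rewrite (sym_central _ (sym_trace x)) mulrDr addrK.
have -> : x * r + x * (s * x) =
    - s * (x * ga_conj x) + (r + s * (x + ga_conj x)) * x.
  rewrite -(sym_central x Rr) mulrA -(sym_central x Rs) -mulrA {1}xxE.
  rewrite mulrBr mulNr (mulrDl r (s * _) x) [RHS]addrC !addrA.
  by congr (_ + _ - _); rewrite mulrA.
apply: memv_add; first by rewrite sym_spaceM ?memvN ?sym_norm.
have -> : (r + s * (x + ga_conj x)) * x = amulr x (r + s * (x + ga_conj x)).
  by rewrite lfunE.
by rewrite memv_img // memvD // sym_spaceM // sym_trace.
Qed.

(** Since r(g^i) = r(g^(|H| - i)), an element of R is determined by its values at g^i for i <=
    |H|/2. *)
Lemma dim_sym_space_cycle g :
  H :=: <[g]>%g -> (\dim sym_space <= (#|H|./2).+1)%N.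
Proof.
move=> defH; pose m := (#|H|./2).+1.
pose f x : 'rV[F]_m := \row_(i < m) x (g ^+ i)%g.
have f_lin : linear f by move=> a x z; apply/rowP=> i; rewrite !mxE !ffunE.
pose fL := GRing.isLinear.Build F A 'rV[F]_m *:%R f f_lin.
pose fl : {linear A -> 'rV[F]_m} := HB.pack f fL.
have ker0 : (sym_space :&: lker (linfun fl) <= 0)%VS.
  apply/subvP=> z /memv_capP[Rz]; rewrite memv_ker lfunE memv0 => /eqP/rowP z0.
  have [r0 rV] := sym_spaceP _ Rz.
  have zm i : (i < m)%N -> z (g ^+ i)%g = 0.
    by move=> im; have := z0 (Ordinal im); rewrite !mxE.
  apply/eqP/ffunP=> h; rewrite [RHS]ffunE.
  have [ | /r0 //] := boolP (h \in H); rewrite defH => /cyclePmin[i lt_i ->].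
  have oH : #|H| = #[g]%g by rewrite defH.
  have [/zm // | mi] := ltnP i m.
  have -> : z (g ^+ i)%g = z (g ^+ (#[g]%g - i))%g.
    rewrite -rV; congr (z _); apply/eqP; rewrite eq_invg_mul -expgD.
    by rewrite subnKC ?expg_order // ltnW.
  apply: zm; rewrite -oH ltnS leq_subLR -[X in (X <= _)%N]odd_double_half.
  rewrite -addnn addnA leq_add2r (leq_trans _ mi) // -[m]add1n leq_add2r.
  exact: leq_b1.
have /eqP k0 : (sym_space :&: lker (linfun fl) == 0)%VS by rewrite -subv0.
rewrite -(limg_ker_dim (linfun fl) sym_space) k0 dimv0 add0n.
apply: leq_trans (dimvS (subvf _)) _.
by rewrite dimvf /dim /= mul1n.
Qed.

End GeneralizedDihedral.

(** * Reflections and rotations in the dihedral group *)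

Section DihedralGroup.

Local Open Scope group_scope.

Lemma dihedral_reflections q : (1 < q)%N ->
  exists s t : 'D_(q.*2), [/\ s * s = 1, t * t = 1,
    <<[set s; t]>> = [set: 'D_(q.*2)],
    #|<[s * t]>| = q &
    [/\ forall g h, g \notin <[s * t]> -> h \notin <[s * t]> -> g * h \in <[s * t]>,
        forall g, g \notin <[s * t]> -> g * g = 1 &
        exists g, g \notin <[s * t]>]].
Proof.
move=> q1; have oG : #|[set: 'D_(q.*2)]| = q.*2 by apply: card_dihedral.
have /existsP[[s t] /= /eqP[defG s2 t2 stq]] := isoGrp_hom (Grp'_dihedral q1).
exists s, t; have genG : <<[set s; t]>> = [set: 'D_(q.*2)].
  by rewrite -defG joing_idl joing_idr.
have ss : s * s = 1 := s2; have tt : t * t = 1 := t2.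
pose g := s * t; have sV : s^-1 = s by apply/eqP; rewrite eq_invg_mul ss.
have gs : g ^ s = g^-1.
  apply/eqP; rewrite eq_sym eq_invg_mul conjgE sV /g !mulgA.
  by rewrite -(mulgA _ s s) ss mulg1 -(mulgA s t t) tt mulg1 ss.
have hs h : h \in <[g]> -> h ^ s = h^-1.
  by case/cycleP=> i ->; rewrite conjXg gs expgVn.
have nHs : <[s]> \subset 'N(<[g]>).
  by rewrite cycle_subG; apply/normP; rewrite -cycleJ gs cycleV.
have GHs : <[g]> * <[s]> = [set: 'D_(q.*2)].
  apply/eqP; rewrite -norm_joinEr // eqEsubset subsetT -genG gen_subG.
  have Ks : s \in <[g]> <*> <[s]> by rewrite (subsetP (joing_subr _ _)) ?cycle_id.
  apply/subsetP=> h /set2P[-> // | ->]; rewrite -(mulKg s t) groupM ?groupV //.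
  by rewrite (subsetP (joing_subl _ _)) ?cycle_id.
(* The relations only bound the orders of [g] and [s] by [q] and 2; as <[g]> <[s]> has 2q elements,
   [g] has order exactly [q]. *)
have Hq : (#|<[g]>| <= q)%N by rewrite dvdn_leq ?(ltnW q1) // order_dvdn stq.
have s2q : (#|<[s]>| <= 2)%N by rewrite dvdn_leq // order_dvdn s2.
have := mul_cardG <[g]> <[s]>; rewrite GHs oG => cardE.
have oH : #|<[g]>| = q.
  apply/eqP; rewrite eqn_leq Hq -(leq_pmul2r (isT : 0 < 2)%N) muln2.
  apply: leq_trans (leq_pmulr _ (cardG_gt0 (<[g]> :&: <[s]>))) _.
  by rewrite -cardE leq_mul2l s2q orbT.
have outH k : k \notin <[g]> -> exists2 h, h \in <[g]> & k = h * s.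
  have : k \in <[g]> * <[s]> by rewrite GHs inE.
  case/mulsgP=> h _ Hh /cycleP[i ->] ->.
  rewrite -(expg_mod _ s2) modn2; case: (odd i); last by rewrite mulg1 Hh.
  by exists h.
have sMs h : h \in <[g]> -> s * (h * s) = h^-1 by move/hs <-; rewrite conjgE sV.
split=> //; split=> [k l /outH[h Hh ->] /outH[h' Hh' ->] | k /outH[h Hh ->] | ].
- by rewrite -mulgA sMs // groupM ?groupV.
- by rewrite -mulgA sMs // mulgV.
have /properP[] : <[g]> \proper [set: 'D_(q.*2)].
  by rewrite properEcard subsetT oG oH -addnn -{1}[q]addn0 ltn_add2l ltnW.
by move=> _ [k _]; exists k.
Qed.

End DihedralGroup.

(** * Upper and lower bounds for the dihedral group algebra *)

Section DihedralLength.

Variables (F : fieldType) (n : nat).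
Hypothesis n_gt1 : (1 < n)%N.

Local Notation D := 'D_(n.*2).
Local Notation A := (group_algebra F D).

Lemma dim_dihedral_algebra : \dim {:A} = n.*2.
Proof. by rewrite dim_group_algebra -cardsT card_dihedral. Qed.

Lemma dihedral_set_length_bound (S : {fset A}) l :
  generating S -> is_set_length S l -> (l <= n + ~~ odd n)%N.
Proof.
move=> genS lS; have [s [t [_ _ _ oH [notHM notH_inv properH]]]] :=
  dihedral_reflections n_gt1.
pose H := [group of <[s * t]>%g].
have /(_ n./2.+1.*2) := set_length_bound _ genS lS.
rewrite dim_dihedral_algebra leq_double => /(_ _)/orP[x | ln |].
- have [U dU U_x] := stable_sym_space notHM notH_inv properH (x : A).
  exists U => //; apply: leq_trans dU _; rewrite leq_double -[in n./2]oH.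
  exact: (@dim_sym_space_cycle F _ H notH_inv (s * t)%g).
- exact: leq_trans ln (leq_addr _ _).
move=> ln; rewrite -ltnS (leq_trans ln) // doubleS ltnS.
by case: (odd n) (odd_double_half n) => /= nE; rewrite -[in leqRHS]nE ?addn0 ?addn1.
Qed.

Lemma long_generating_set :
  exists2 S : {fset A}, generating S &
    forall l, is_set_length S l -> (n <= l)%N.
Proof.
have [s [t [ss tt gen_st _ _]]] := dihedral_reflections n_gt1.
exists [fset ga_elt F s; ga_elt F t]%fset.
  apply: generating_group_elements gen_st _ => g.
  by rewrite !inE => /orP[] /eqP->; rewrite eqxx ?orbT.
(* It suffices that 2n = dim L_l < 2l + 2, which follows from dim L_l <= 2l + 1. *)
move=> l [Ll _]; rewrite -ltnS -ltn_double -dim_dihedral_algebra -Ll.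
have S_st : {subset [fset ga_elt F s; ga_elt F t]%fset
               <= [:: ga_elt F s; ga_elt F t]}.
  by move=> x; rewrite !inE.
have sq (g : D) : (g * g = 1)%g -> ga_elt F g * ga_elt F g = 1.
  by rewrite -ga_eltM => ->.
apply: leq_ltn_trans (dimvS (words_span_involutions l S_st (sq _ ss) (sq _ tt))) _.
exact: leq_ltn_trans (dim_alt_span _ _ _) _.
Qed.

End DihedralLength.

Theorem theorem4p11 (F : fieldType) (n : nat) (hn : (3 <= n)%N) :
  (odd n -> is_algebra_length (group_algebra F 'D_(n.*2)) n) /\
  (~~ odd n ->
     is_algebra_length (group_algebra F 'D_(n.*2)) n \/
     is_algebra_length (group_algebra F 'D_(n.*2)) n.+1).
Proof.
have n_gt1 : (1 < n)%N by apply: ltnW.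
have [S genS leS] := long_generating_set F n_gt1.
have [k lS] := generating_length genS; have nk := leS _ lS.
have ub := @dihedral_set_length_bound F n n_gt1.
split=> [odd_n | even_n].
  have ubn (T : {fset group_algebra F 'D_(n.*2)}) l :
      generating T -> is_set_length T l -> (l <= n)%N.
    by move=> genT lT; have := ub _ _ genT lT; rewrite odd_n addn0.
  split=> //; exists S; split=> //.
  by move: (lS); rewrite (_ : k = n) //; apply/eqP; rewrite eqn_leq nk (ubn S).
(* For even [n] all lengths are at most n + 1: either this value is attained, or the bound drops to
   [n], which [S] attains. *)
have [[T [genT lT]] | noT] := classic (exists T : {fset group_algebra F 'D_(n.*2)},
    generating T /\ is_set_length T n.+1).
  right; split=> [|U l genU lU]; first by exists T.
  by have := ub _ _ genU lU; rewrite even_n addn1.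
have ubn (T : {fset group_algebra F 'D_(n.*2)}) l :
    generating T -> is_set_length T l -> (l <= n)%N.
  move=> genT lT; have := ub _ _ genT lT; rewrite even_n addn1 leq_eqVlt.
  by case/predU1P=> // lE; case: noT; exists T; rewrite -lE.
left; split=> //; exists S; split=> //.
by move: (lS); rewrite (_ : k = n) //; apply/eqP; rewrite eqn_leq nk (ubn S).
Qed.
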